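(* Let $M\in\mathbb{R}^{d\times d}$ be symmetric positive definite, let $S\in\mathbb{R}^{d\times d}$ be constant with $S^\top=-S$ or $S\preceq0$, let $V:\mathbb{R}^d\to\mathbb{R}$ be differentiable, and let $C>0$ satisfy $V(z)+C>0$ for all $z$. Let $D(t)\in\mathbb{R}^{d\times d}$ be continuous in $t$ with $\operatorname{sym}(MD(t))\succeq0$ for all $t$. Let $h>0$, $t_{n+1}=t_n+h$, $A=hSM$, and let $(z^n,r^n),(z^{n+1},r^{n+1})\in\mathbb{R}^d\times\mathbb{R}$ be related by one step of the SEISAV scheme, with precomputed predictor $\hat z^{\,n+\frac12}\in\mathbb{R}^d$ and $\tilde g=\nabla V(\hat z^{\,n+\frac12})/\sqrt{V(\hat z^{\,n+\frac12})+C}$: $$(z^-,r^-)=\big(\Psi^{(t_n,\,t_n+\frac h2)}z^n,\;r^n\big),$$ $$z^+=e^Az^-+\tfrac h2\,\varphi_1(A)\,S\,(r^++r^-)\,\tilde g,\qquad r^+-r^-=\tfrac12\,\tilde g^\top(z^+-z^-),$$ $$(z^{n+1},r^{n+1})=\big(\Psi^{(t_n+\frac h2,\,t_{n+1})}z^+,\;r^+\big).$$ Then the modified energy $\tilde H(z,r)=\tfrac12z^\top Mz+r^2-C$ is dissipated: $$\tilde H(z^{n+1},r^{n+1})-\tilde H(z^n,r^n)\le0 .$$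
   Context: $\operatorname{sym}(B)=\tfrac12(B+B^\top)$. $B\succeq0$ means symmetric positive semidefinite. $S\preceq0$ means that $\operatorname{sym}(S)$ is negative semidefinite ($S$ need not be symmetric). $\Psi^{(a,b)}=\exp\big(-\int_a^bD(\tau)\,d\tau\big)$ is the evolution operator of the linear damping subflow $\dot z=-D(t)z$. $\varphi_1(x)=\frac{e^x-1}{x}$ is the entire function $\sum_{k\ge0}x^k/(k+1)!$, applied to matrices through its power series. The vector $\hat z^{\,n+\frac12}$ is an input to the step, computed beforehand; in practice it is a locally second-order approximation of the solution at $t_n+h/2$ in the Hamiltonian step. The scheme is a Strang splitting for $\dot z=S\nabla H(z)-D(t)z$ with $H(z)=\tfrac12z^\top Mz+V(z)$, where $r$ represents $\sqrt{V(z)+C}$. *)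

(* Defs.v *)
From HB Require Import structures.
From mathcomp Require Import all_boot all_order all_algebra.
From mathcomp Require Import all_classical all_reals all_analysis.

Set Implicit Arguments.
Unset Strict Implicit.
Unset Printing Implicit Defensive.

Import Order.TTheory GRing.Theory Num.Theory.
Import numFieldNormedType.Exports.

Local Open Scope classical_set_scope.
Local Open Scope ring_scope.

Definition dotcv (R : realType) (d : nat) (u v : 'cV[R]_d) : R :=
  (u^T *m v) 0 0.

Definition quadmx (R : realType) (d : nat) (B : 'M[R]_d) (x : 'cV[R]_d) : R :=
  dotcv x (B *m x).

Definition symmx (R : realType) (d : nat) (B : 'M[R]_d) : 'M[R]_d :=
  2^-1 *: (B + B^T).

Definition posdefmx (R : realType) (d : nat) (B : 'M[R]_d) : Prop :=
  B^T = B /\ forall x : 'cV[R]_d, x != 0 -> 0 < quadmx B x.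

Definition possemidefmx (R : realType) (d : nat) (B : 'M[R]_d) : Prop :=
  B^T = B /\ forall x : 'cV[R]_d, 0 <= quadmx B x.

Definition negsemidefmx (R : realType) (d : nat) (B : 'M[R]_d) : Prop :=
  B^T = B /\ forall x : 'cV[R]_d, quadmx B x <= 0.

(* Limits are taken in the library's normed-space topology on 'M[R]_d. *)
Definition expmx (R : realType) (d : nat) (A : 'M[R]_d) : 'M[R]_d :=
  limn (series (fun k : nat => k`!%:R^-1 *: A ^+ k)).

(* The entire function (e^x - 1) / x; the matrix A need not be invertible. *)
Definition phi1mx (R : realType) (d : nat) (A : 'M[R]_d) : 'M[R]_d :=
  limn (series (fun k : nat => (k.+1)`!%:R^-1 *: A ^+ k)).

Definition integralmx (R : realType) (d : nat) (D : R -> 'M[R]_d) (a b : R) :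
    'M[R]_d :=
  \matrix_(i, j) \int[lebesgue_measure]_(t in `[a, b]) D t i j.

(* This is the evolution operator of z' = - D(t) z when the D(t) commute;
   in general it is the exponential of the integral, not the time-ordered one. *)
Definition damping_flow (R : realType) (d : nat) (D : R -> 'M[R]_d) (a b : R) :
    'M[R]_d :=
  expmx (- integralmx D a b).

Definition gradient (R : realType) (d : nat) (V : 'cV[R]_d -> R)
    (z : 'cV[R]_d) : 'cV[R]_d :=
  \col_(i < d) 'D_(delta_mx i 0) V z.

Definition sav_direction (R : realType) (d : nat) (V : 'cV[R]_d -> R) (C : R)
    (zhat : 'cV[R]_d) : 'cV[R]_d :=
  (Num.sqrt (V zhat + C))^-1 *: gradient V zhat.

(* A relation between the states at times t and t' = t + h, since the equations
   for (zp, rp) are implicit. *)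
Definition seisav_step (R : realType) (d : nat) (M S : 'M[R]_d)
    (V : 'cV[R]_d -> R) (C : R) (D : R -> 'M[R]_d) (h t t' : R)
    (zhat : 'cV[R]_d) (zr zr' : 'cV[R]_d * R) : Prop :=
  let A := h *: (S *m M) in
  let g := sav_direction V C zhat in
  exists (zm zp : 'cV[R]_d) (rm rp : R),
    [/\ (zm, rm) = (damping_flow D t (t + h / 2) *m zr.1, zr.2),
        zp = expmx A *m zm
             + (h / 2) *: (phi1mx A *m S *m ((rp + rm) *: g)),
        rp - rm = 2^-1 * dotcv g (zp - zm)
      & zr' = (damping_flow D (t + h / 2) t' *m zp, rp)].

Definition modified_energy (R : realType) (d : nat) (M : 'M[R]_d) (C : R)
    (zr : 'cV[R]_d * R) : R :=
  2^-1 * quadmx M zr.1 + zr.2 ^+ 2 - C.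

(* Main.v *)
Require Import Defs.
From mathcomp Require Import all_boot all_order all_algebra.
From mathcomp Require Import all_classical all_reals all_analysis.
From mathcomp Require Import ring lra.

Import Order.TTheory GRing.Theory Num.Theory.
Import numFieldNormedType.Exports.

Local Open Scope classical_set_scope.
Local Open Scope ring_scope.

(** With the values of the scalar variable frozen, the step is a composition of
    three exact flows of affine equations with constant coefficients, and each
    of them decreases a suitable quadratic energy.

    Write [x(s)] for the solution of [x' = B x + b], [x(0) = z]. Then
    [x(1) = expmx B *m z + phi1mx B *m b] ([affine_flow1]). If [M] is symmetric
    and the energy [E(x) = x^T M x / 2 + g^T x] satisfies
    [(M x + g)^T (B x + b) <= 0] for all [x], then [E] does not increase along
    [x(s)], so [E(x(1)) <= E(z)] ([quad_energy_flow_le]). Two instances suffice.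

    In a damping half-step, [g = b = 0] and [B] is minus the integral of [D].
    The quadratic form of [M B] is minus the integral of that of [M D(t)], hence
    nonpositive, so the [M]-energy does not increase ([damping_flow_le]).

    In the Hamiltonian step, put [gbar = (rp + rm) / 2 *: g], where [g] is the
    frozen direction. Then [B = h S M], [b = h S gbar], and
    [(M x + gbar)^T (B x + b)] is [h] times the quadratic form of [S] at
    [M x + gbar], which is nonpositive ([hamiltonian_flow_le]). The equation for
    [r] gives [rp^2 - rm^2 = gbar^T (zp - zm)], so the decay of
    [x^T M x / 2 + gbar^T x] is exactly that of [x^T M x / 2 + r^2].

    The affine flow is handled entrywise, as power series whose coefficients are
    dominated by those of an exponential; this yields both the convergence of
    the matrix series and the differential equation ([is_derive_affine_flow]). *)

Set Implicit Arguments.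
Unset Strict Implicit.

(** * Euclidean products and quadratic forms *)

Lemma dotcvE (R : realType) (d : nat) (u v : 'cV[R]_d) :
  dotcv u v = \sum_i u i 0 * v i 0.
Proof. by rewrite /dotcv mxE; apply: eq_bigr => i _; rewrite mxE. Qed.

Lemma dotcvC (R : realType) (d : nat) (u v : 'cV[R]_d) : dotcv u v = dotcv v u.
Proof. by rewrite !dotcvE; apply: eq_bigr => i _; rewrite mulrC. Qed.

Lemma dotcvDl (R : realType) (d : nat) (u v w : 'cV[R]_d) :
  dotcv (u + v) w = dotcv u w + dotcv v w.
Proof. by rewrite /dotcv linearD mulmxDl mxE. Qed.

Lemma dotcvDr (R : realType) (d : nat) (u v w : 'cV[R]_d) :
  dotcv u (v + w) = dotcv u v + dotcv u w.
Proof. by rewrite /dotcv mulmxDr mxE. Qed.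

Lemma dotcvZl (R : realType) (d : nat) (a : R) (u v : 'cV[R]_d) :
  dotcv (a *: u) v = a * dotcv u v.
Proof. by rewrite /dotcv linearZ -scalemxAl mxE. Qed.

Lemma dotcvZr (R : realType) (d : nat) (a : R) (u v : 'cV[R]_d) :
  dotcv u (a *: v) = a * dotcv u v.
Proof. by rewrite /dotcv -scalemxAr mxE. Qed.

Lemma dotcvNr (R : realType) (d : nat) (u v : 'cV[R]_d) :
  dotcv u (- v) = - dotcv u v.
Proof. by rewrite -scaleN1r dotcvZr mulN1r. Qed.

Lemma dotcv0l (R : realType) (d : nat) (u : 'cV[R]_d) : dotcv 0 u = 0.
Proof. by rewrite /dotcv linear0 mul0mx mxE. Qed.

Lemma dotcv_mulmx (R : realType) (d : nat) (A : 'M[R]_d) (u v : 'cV[R]_d) :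
  dotcv u (A *m v) = dotcv (A^T *m u) v.
Proof. by rewrite /dotcv trmx_mul trmxK mulmxA. Qed.

(** A sum over index pairs: it displays the bilinear form as a linear function
    of the entries of [A], which is what lets an integral pass through it. *)
Lemma dotcv_mulmxE (R : realType) (d : nat) (A : 'M[R]_d) (u v : 'cV[R]_d) :
  dotcv u (A *m v) = \sum_(p : 'I_d * 'I_d) u p.1 0 * v p.2 0 * A p.1 p.2.
Proof.
rewrite dotcvE -(pair_big xpredT xpredT
  (fun i j => u i 0 * v j 0 * A i j)) /=; apply: eq_bigr => i _.
rewrite mxE mulr_sumr; apply: eq_bigr => j _.
by rewrite -mulrA [v j 0 * _]mulrC.
Qed.

Lemma quadmx_symmx (R : realType) (d : nat) (B : 'M[R]_d) (x : 'cV[R]_d) :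
  quadmx (symmx B) x = quadmx B x.
Proof.
rewrite /quadmx /symmx -scalemxAl mulmxDl dotcvZr dotcvDr.
rewrite (dotcv_mulmx B^T) trmxK (dotcvC (B *m x)); lra.
Qed.

Lemma quadmx_le0 (R : realType) (d : nat) (S : 'M[R]_d) (x : 'cV[R]_d) :
  S^T = - S \/ negsemidefmx (symmx S) -> quadmx S x <= 0.
Proof.
case=> [antiS|[_ /(_ x)]]; last by rewrite quadmx_symmx.
suff : quadmx S x = - quadmx S x by lra.
by rewrite {1}/quadmx dotcv_mulmx antiS mulNmx dotcvC dotcvNr.
Qed.

(** * Limits of matrix sequences *)

Lemma is_cvg_mx (R : realType) (m n : nat) (u : nat -> 'M[R]_(m, n)) :
  (forall i j, cvgn (fun k => u k i j)) -> cvgn u.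
Proof.
move=> cu; apply/cvg_ex; exists (\matrix_(i, j) limn (fun k => u k i j)).
apply/cvg_ballP => e e0.
have H : \forall k \near \oo, forall p : 'I_m * 'I_n,
    ball (limn (fun k => u k p.1 p.2)) e (u k p.1 p.2).
  apply: filter_forall => p; have /cvg_ballP := cu p.1 p.2; exact.
by apply: filterS H => k Hk; split=> // i j; rewrite mxE; exact: (Hk (i, j)).
Qed.

Lemma cvg_mx_coord (R : realType) (m n : nat) (u : nat -> 'M[R]_(m, n)) i j :
  cvgn u -> (fun k => u k i j) @ \oo --> (limn u) i j.
Proof.
by move=> cu; exact: (continuous_cvg _ (@coord_continuous R m n i j _) cu).
Qed.

Lemma cvg_mulmx_coord (R : realType) (m n : nat) (u : nat -> 'M[R]_(m, n))
    (v : 'cV[R]_n) i :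
  cvgn u -> (fun k => (u k *m v) i 0) @ \oo --> (limn u *m v) i 0.
Proof.
move=> cu; under eq_fun do rewrite mxE; rewrite mxE.
apply: cvg_big => [|j _]; first exact: add_continuous.
apply: cvgM; last exact: cvg_cst.
exact: cvg_mx_coord.
Qed.

(** * Power series with exponentially bounded coefficients *)

(** The coefficients [c] are dominated by those of an exponential series
    [N * exp (a x)]. The power series is then entire, and the condition is
    stable under termwise differentiation. *)
Definition exp_bounded (R : realType) (c : nat -> R) : Prop :=
  exists N a : R, 0 <= a /\ forall k, `|c k| <= N * exp_coeff a k.

Lemma exp_bounded_diffs (R : realType) (c : nat -> R) :
  exp_bounded c -> exp_bounded (pseries_diffs c).
Proof.
case=> N [a [a0 cNa]]; exists (N * a), a; split=> // k.
rewrite /pseries_diffs normrM normr_nat.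
apply: (le_trans (ler_wpM2l (ler0n _ _) (cNa k.+1))).
rewrite /exp_coeff/= factS natrM exprS invfM.
rewrite [leLHS](_ : _ = N * a * (a ^+ k / k`!%:R) * (k.+1%:R / k.+1%:R)).
  by rewrite divff ?mulr1// pnatr_eq0.
by move: (_^-1) (_^-1) => x y; ring.
Qed.

Lemma exp_bounded_cvg (R : realType) (c : nat -> R) (x : R) :
  exp_bounded c -> cvgn (pseries c x).
Proof.
case=> N [a [a0 cNa]]; apply: normed_cvg.
have N0 : 0 <= N.
  by have := cNa 0; rewrite /exp_coeff/= expr0 divr1 mulr1; exact: le_trans.
have E0 n : 0 <= (N *: exp_coeff (a * `|x|)) n.
  by apply: mulr_ge0 => //; apply: exp_coeff_ge0; rewrite mulr_ge0.
apply: (@series_le_cvg _ _ (N *: exp_coeff (a * `|x|))) => //.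
  by move=> n; exact: normr_ge0.
  move=> n /=; rewrite normrM normrX.
  apply: (le_trans (ler_wpM2r _ (cNa n))); first exact: exprn_ge0.
  rewrite [leRHS](_ : _ = N * ((a * `|x|) ^+ n / n`!%:R))// exprMn /exp_coeff/=.
  by move: (_^-1) => y; rewrite le_eqVlt; apply/orP; left; apply/eqP; ring.
by apply: is_cvg_seriesZ; exact: is_cvg_series_exp_coeff.
Qed.

Lemma is_derive_pseries (R : realType) (c : nat -> R) (x : R) :
  exp_bounded c ->
  is_derive x (1 : R) (fun s => limn (pseries c s))
    (limn (pseries (pseries_diffs c) x)).
Proof.
move=> bc; apply: (@pseries_snd_diffs _ _ (`|x| + 1)).
- exact: exp_bounded_cvg.
- exact/exp_bounded_cvg/exp_bounded_diffs.
- exact/exp_bounded_cvg/exp_bounded_diffs/exp_bounded_diffs.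
- by rewrite [ltRHS]ger0_norm ?addr_ge0// ltrDl.
Qed.

Lemma limn_pseries0 (R : realType) (c : nat -> R) : limn (pseries c 0) = c 0.
Proof.
apply: cvg_lim => //; rewrite -cvg_shiftS; apply: cvg_near_cst.
apply: nearW => n; rewrite /pseries /series/= big_nat_recl// expr0 mulr1.
by rewrite big1 ?addr0// => i _; rewrite expr0n mulr0.
Qed.

(** The bound [a] is at least 1, rather than just an operator norm, so that
    [a ^+ k <= a ^+ k.+1]; this absorbs shifts of the index. *)
Lemma mulmx_exp_bound (R : realType) (d : nat) (B : 'M[R]_d) (v : 'cV[R]_d) :
  exists N a : R, [/\ 0 <= N, 1 <= a &
    forall k i, `|(B ^+ k *m v) i 0| <= N * a ^+ k].
Proof.
exists (\sum_j `|v j 0|), (1 + \sum_i \sum_j `|B i j|); split.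
- exact: sumr_ge0.
- by rewrite lerDl; apply: sumr_ge0 => i _; exact: sumr_ge0.
pose N := \sum_j `|v j 0|; pose a := 1 + \sum_i \sum_j `|B i j|.
rewrite -/N -/a.
have N0 : 0 <= N by rewrite /N; exact: sumr_ge0.
have a0 : 0 <= a.
  by rewrite /a addr_ge0//; apply: sumr_ge0 => i _; exact: sumr_ge0.
elim=> [|k IHk] i.
  rewrite -[B ^+ 0]/(1%:M) mul1mx expr0 mulr1 /N (bigD1 i)//= lerDl.
  exact: sumr_ge0.
rewrite exprS -mulmxE -mulmxA mxE; apply: (le_trans (ler_norm_sum _ _ _)).
apply: (@le_trans _ _ (\sum_j `|B i j| * (N * a ^+ k))).
  by apply: ler_sum => j _; rewrite normrM ler_wpM2l.
rewrite -mulr_suml exprS [leRHS]mulrCA ler_wpM2r//.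
  by rewrite mulr_ge0// exprn_ge0.
rewrite /a [X in _ <= 1 + X](bigD1 i)//= addrCA lerDl addr_ge0//.
by apply: sumr_ge0 => l _; exact: sumr_ge0.
Qed.

(** * The flow of an affine equation *)

(** Taylor coefficients in [s] of the solution of [x' = B x + b], [x(0) = z]. *)
Definition affine_coeff (R : realType) (d : nat) (B : 'M[R]_d) (b z : 'cV[R]_d)
    (k : nat) : 'cV[R]_d :=
  if k is k'.+1 then k`!%:R^-1 *: (B ^+ k' *m (B *m z + b)) else z.

(** The solution at time [s] of [x' = B x + b], [x(0) = z], defined entrywise as
    a scalar power series so that it can be differentiated term by term. *)
Definition affine_flow (R : realType) (d : nat) (B : 'M[R]_d) (b z : 'cV[R]_d)
    (s : R) : 'cV[R]_d :=
  \col_i limn (pseries (fun k => affine_coeff B b z k i 0) s).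

Lemma affine_coeff_bounded (R : realType) (d : nat) (B : 'M[R]_d)
    (b z : 'cV[R]_d) (i : 'I_d) :
  exp_bounded (fun k => affine_coeff B b z k i 0).
Proof.
have [N [a [N0 a1 vNa]]] := mulmx_exp_bound B (B *m z + b).
have a0 : 0 <= a by apply: le_trans a1.
exists (N + `|z i 0|), a; split=> // -[|k].
  by rewrite /exp_coeff/= expr0 divr1 mulr1 lerDr.
rewrite /affine_coeff mxE normrM ger0_norm ?invr_ge0// mulrC.
rewrite /exp_coeff/= mulrA ler_wpM2r ?invr_ge0//.
apply: (le_trans (vNa k i)); apply: ler_pM => //; first exact: exprn_ge0.
  by rewrite lerDl.
by rewrite exprS ler_peMl// exprn_ge0.
Qed.

Lemma affine_flow0 (R : realType) (d : nat) (B : 'M[R]_d) (b z : 'cV[R]_d) :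
  affine_flow B b z 0 = z.
Proof. by apply/colP => i; rewrite mxE limn_pseries0. Qed.

(** The differential equation [x' = B x + b] read on Taylor coefficients. *)
Lemma affine_coeff_diffs (R : realType) (d : nat) (B : 'M[R]_d)
    (b z : 'cV[R]_d) (i : 'I_d) (k : nat) :
  pseries_diffs (fun l => affine_coeff B b z l i 0) k =
  (B *m affine_coeff B b z k) i 0 + (k == 0)%:R * b i 0.
Proof.
rewrite /pseries_diffs [affine_coeff _ _ _ k.+1]/affine_coeff mxE factS natrM.
rewrite invfM mulrA mulVKf ?pnatr_eq0//.
case: k => [|k]; last first.
  by rewrite mul0r addr0 /affine_coeff -scalemxAr [RHS]mxE exprS -mulmxE mulmxA.
by rewrite -[B ^+ 0]/(1%:M) mul1mx invr1 !mul1r mxE.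
Qed.

Lemma is_derive_affine_flow (R : realType) (d : nat) (B : 'M[R]_d)
    (b z : 'cV[R]_d) (i : 'I_d) (s : R) :
  is_derive s (1 : R) (fun t => affine_flow B b z t i 0)
    ((B *m affine_flow B b z s + b) i 0).
Proof.
have bnd j := affine_coeff_bounded B b z j.
have -> : (fun t => affine_flow B b z t i 0) =
    (fun t => limn (pseries (fun k => affine_coeff B b z k i 0) t)).
  by apply/funext => t; rewrite mxE.
apply: is_derive_eq (is_derive_pseries s (bnd i)) _.
(* The constant term b only occurs at index 0, so it is present in the partial
   sums from length 1 on: hence the shift. *)
apply: cvg_lim => //; rewrite -cvg_shiftS.
have E n : pseries (pseries_diffs (fun k => affine_coeff B b z k i 0)) s n.+1 =
    \sum_j B i j * pseries (fun k => affine_coeff B b z k j 0) s n.+1 + b i 0.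
  rewrite /pseries /series/=.
  under eq_bigr do rewrite affine_coeff_diffs mulrDl.
  rewrite big_split/=; congr +%R.
    under eq_bigr do rewrite mxE mulr_suml.
    rewrite exchange_big/=; apply: eq_bigr => j _; rewrite mulr_sumr.
    by apply: eq_bigr => k _; rewrite mulrA.
  rewrite big_nat_recl// expr0 mul1r mulr1 big1 ?addr0// => k _.
  by rewrite !mul0r.
under eq_fun do rewrite /= E.
rewrite mxE; apply: cvgD; last exact: cvg_cst.
rewrite mxE; apply: cvg_big => [|j _]; first exact: add_continuous.
rewrite mxE; apply: cvgM; first exact: cvg_cst.
rewrite (cvg_shiftS (pseries _ s)); exact: exp_bounded_cvg.
Qed.

Lemma is_cvg_mx_series (R : realType) (d : nat) (B : 'M[R]_d) (f : nat -> R) :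
  (forall k, `|f k| <= k`!%:R^-1) -> cvgn (series (fun k => f k *: B ^+ k)).
Proof.
move=> fk; apply: is_cvg_mx => i j.
have -> : (fun k => series (fun l => f l *: B ^+ l) k i j) =
    pseries (fun k => f k * (B ^+ k) i j) 1.
  apply/funext => k; rewrite /pseries /series/= summxE.
  by apply: eq_bigr => l _; rewrite mxE expr1n mulr1.
apply: exp_bounded_cvg.
have [N [a [N0 a1 vNa]]] := mulmx_exp_bound B (delta_mx j 0).
exists N, a; split=> [|k]; first exact: le_trans a1.
have -> : (B ^+ k) i j = (B ^+ k *m delta_mx j 0 : 'cV[R]_d) i 0.
  by rewrite -colE mxE.
by rewrite normrM mulrC /exp_coeff/= mulrA ler_pM.
Qed.

Lemma is_cvg_expmx (R : realType) (d : nat) (B : 'M[R]_d) :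
  cvgn (series (fun k : nat => k`!%:R^-1 *: B ^+ k)).
Proof. by apply: is_cvg_mx_series => k; rewrite ger0_norm ?invr_ge0. Qed.

Lemma is_cvg_phi1mx (R : realType) (d : nat) (B : 'M[R]_d) :
  cvgn (series (fun k : nat => (k.+1)`!%:R^-1 *: B ^+ k)).
Proof.
apply: is_cvg_mx_series => k; rewrite ger0_norm ?invr_ge0//.
rewrite lef_pV2 ?posrE ?ltr0n ?fact_gt0// ler_nat factS.
by rewrite leq_pmull.
Qed.

(** Variation of constants: the affine flow at time 1 is the exponential
    integrator built from [expmx] and [phi1mx]. *)
Lemma affine_flow1 (R : realType) (d : nat) (B : 'M[R]_d) (b z : 'cV[R]_d) :
  affine_flow B b z 1 = expmx B *m z + phi1mx B *m b.
Proof.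
apply/colP => i; rewrite mxE; apply: cvg_lim => //; rewrite -cvg_shiftS.
(* Splitting off the term k = 0, the remaining coefficients contribute B^(k+1) z
   to the exponential series and B^k b to the phi1 series, one term behind. *)
have E n : pseries (fun k => affine_coeff B b z k i 0) 1 n.+1 =
    (series (fun k => k`!%:R^-1 *: B ^+ k) n.+1 *m z +
     series (fun k => (k.+1)`!%:R^-1 *: B ^+ k) n *m b) i 0.
  rewrite /series/= /pseries/series/= !big_nat_recl// mulmxDl.
  rewrite -addrA mulmx_suml mulmx_suml -big_split/= mxE invr1 scale1r.
  rewrite -[B ^+ 0]/(1%:M) mul1mx expr0 mulr1; congr +%R.
  rewrite summxE; apply: eq_bigr => k _; rewrite expr1n mulr1.
  rewrite /affine_coeff mulmxDr mulmxA exprSr -mulmxE scalerDr.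
  by rewrite !scalemxAl.
under eq_fun do rewrite /= E mxE.
rewrite mxE; apply: cvgD.
  rewrite (cvg_shiftS (fun n => (series _ n *m z) i 0)).
  exact/cvg_mulmx_coord/is_cvg_expmx.
exact/cvg_mulmx_coord/is_cvg_phi1mx.
Qed.

(** * Energy decay along the flow *)

(** Quadratic energy with a linear term; its gradient is [M x + g] for
    symmetric [M]. *)
Definition quad_energy (R : realType) (d : nat) (M : 'M[R]_d)
    (g x : 'cV[R]_d) : R :=
  2^-1 * quadmx M x + dotcv g x.

Lemma is_derive_dotcv (R : realType) (d : nat) (x y : R -> 'cV[R]_d)
    (dx dy : 'cV[R]_d) (s : R) :
  (forall i, is_derive s (1 : R) (fun t => x t i 0) (dx i 0)) ->
  (forall i, is_derive s (1 : R) (fun t => y t i 0) (dy i 0)) ->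
  is_derive s (1 : R) (fun t => dotcv (x t) (y t))
    (dotcv (x s) dy + dotcv dx (y s)).
Proof.
move=> xd yd.
have -> : (fun t => dotcv (x t) (y t)) =
    \sum_i ((fun t => x t i 0) * (fun t => y t i 0)).
  by apply/funext => t; rewrite dotcvE fct_sumE.
apply: is_derive_eq.
rewrite big_split/= !dotcvE; congr +%R; apply: eq_bigr => i _ //.
by rewrite /GRing.scale/= mulrC.
Qed.

Lemma is_derive_mulmx (R : realType) (d : nat) (A : 'M[R]_d) (x : R -> 'cV[R]_d)
    (dx : 'cV[R]_d) (s : R) :
  (forall i, is_derive s (1 : R) (fun t => x t i 0) (dx i 0)) ->
  forall i, is_derive s (1 : R) (fun t => (A *m x t) i 0) ((A *m dx) i 0).
Proof.
move=> xd i.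
have -> : (fun t => (A *m x t) i 0) = \sum_j (A i j \*: (fun t => x t j 0)).
  by apply/funext => t; rewrite mxE fct_sumE.
apply: is_derive_eq.
by rewrite mxE.
Qed.

Lemma is_derive_quad_energy (R : realType) (d : nat) (M : 'M[R]_d)
    (g : 'cV[R]_d) (x : R -> 'cV[R]_d) (dx : 'cV[R]_d) (s : R) :
  M^T = M ->
  (forall i, is_derive s (1 : R) (fun t => x t i 0) (dx i 0)) ->
  is_derive s (1 : R) (fun t => quad_energy M g (x t))
    (dotcv (M *m x s + g) dx).
Proof.
move=> symM xd.
apply: is_derive_eq.
  apply: is_deriveD; last first.
    apply: (@is_derive_dotcv _ _ (fun=> g) x 0 dx) => // i.
    by rewrite mxE; exact: is_derive_cst.
  apply: is_deriveZ; apply: (is_derive_dotcv xd); exact: is_derive_mulmx.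
rewrite /= dotcv_mulmx symM dotcvDl (dotcvC dx) dotcv0l addr0.
by rewrite /GRing.scale/=; lra.
Qed.

(** Lyapunov argument: if the derivative of the energy along the vector field
    [B x + b] is nowhere positive, the energy decreases over a unit time. *)
Lemma quad_energy_flow_le (R : realType) (d : nat) (M B : 'M[R]_d)
    (g b z : 'cV[R]_d) :
  M^T = M -> (forall x, dotcv (M *m x + g) (B *m x + b) <= 0) ->
  quad_energy M g (expmx B *m z + phi1mx B *m b) <= quad_energy M g z.
Proof.
move=> symM decr; rewrite -affine_flow1 -{2}(affine_flow0 B b z).
pose f s := quad_energy M g (affine_flow B b z s).
have df s : is_derive s (1 : R) f _ :=
  is_derive_quad_energy g symM (fun i => is_derive_affine_flow B b z i s).
have derf s : derivable f s 1 by have [] := df s.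
rewrite -!/(f _).
apply: (@ler0_derive1_le_cc _ f 0 1) => //; rewrite ?in_itv/= ?lexx ?ler01//.
- by move=> s _; rewrite derive1E derive_val.
- exact: derivable_within_continuous.
Qed.

(** * The two subflows of the splitting *)

Lemma Rintegral_sum (d : measure_display) (T : measurableType d) (R : realType)
    (mu : {measure set T -> \bar R}) (A : set T) (I : Type) (r : seq I)
    (f : I -> T -> R) :
  measurable A -> (forall i, mu.-integrable A (EFin \o f i)) ->
  \int[mu]_(t in A) (\sum_(i <- r) f i t) =
  \sum_(i <- r) \int[mu]_(t in A) f i t.
Proof.
move=> mA intf; elim: r => [|i r IHr].
  rewrite big_nil; under eq_Rintegral do rewrite big_nil.
  by rewrite Rintegral_cst// mul0r.
rewrite big_cons -IHr -RintegralD//.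
  by under eq_Rintegral do rewrite big_cons.
have -> : EFin \o (fun t => \sum_(j <- r) f j t) =
    (fun t => \sum_(j <- r) (EFin \o f j) t)%E.
  by apply/funext => t /=; rewrite sumEFin.
exact: integrable_sum.
Qed.

Lemma quadmx_integralmx_ge0 (R : realType) (d : nat) (M : 'M[R]_d)
    (D : R -> 'M[R]_d) (a b : R) (x : 'cV[R]_d) :
  continuous D -> (forall t, 0 <= quadmx (M *m D t) x) ->
  0 <= quadmx (M *m integralmx D a b) x.
Proof.
move=> cD D0; rewrite /quadmx -mulmxA dotcv_mulmx dotcv_mulmxE.
set c := fun p : 'I_d * 'I_d => (M^T *m x) p.1 0 * x p.2 0.
have contD p : continuous (fun t => D t p.1 p.2 : R).
  move=> t; apply: (@continuous_cvg _ _ _ _ _ D (fun A : 'M[R]_d => A p.1 p.2)).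
    exact: coord_continuous.
  exact: cD.
have int_cont (f : R -> R) : continuous f ->
    lebesgue_measure.-integrable `[a, b] (EFin \o f).
  move=> cf; apply: continuous_compact_integrable; first exact: segment_compact.
  exact: continuous_subspaceT.
have -> : \sum_(p : 'I_d * 'I_d)
      (M^T *m x) p.1 0 * x p.2 0 * integralmx D a b p.1 p.2 =
    \int[lebesgue_measure]_(t in `[a, b])
      \sum_(p : 'I_d * 'I_d) c p * D t p.1 p.2.
  rewrite Rintegral_sum// => [|p]; last first.
    by apply: int_cont => t; apply: cvgM; [exact: cvg_cst|exact: contD].
  apply: eq_bigr => p _; rewrite [integralmx _ _ _ _ _]mxE RintegralZl//.
  exact/int_cont/contD.
apply: Rintegral_ge0 => t _.
by have := D0 t; rewrite /quadmx -mulmxA dotcv_mulmx dotcv_mulmxE.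
Qed.

(** The exponential of the integrated damping contracts the [M]-norm even when
    the matrices [D t] do not commute: nonnegativity of the quadratic form of
    [M D(t)] passes to the integral of [D], and the exponential of a constant
    matrix is the flow of an autonomous equation. *)
Lemma damping_flow_le (R : realType) (d : nat) (M : 'M[R]_d) (D : R -> 'M[R]_d)
    (a b : R) (z : 'cV[R]_d) :
  M^T = M -> continuous D -> (forall t x, 0 <= quadmx (M *m D t) x) ->
  quadmx M (damping_flow D a b *m z) <= quadmx M z.
Proof.
move=> symM cD D0.
have decr x : dotcv (M *m x + 0) (- integralmx D a b *m x + 0) <= 0.
  rewrite !addr0 mulNmx dotcvNr oppr_le0.
  rewrite -{1}symM -dotcv_mulmx mulmxA.
  exact: quadmx_integralmx_ge0.
have := quad_energy_flow_le z symM decr.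
by rewrite mulmx0 addr0 /quad_energy !dotcv0l !addr0 ler_pM2l// invr_gt0.
Qed.

(** One step is the time-[h] flow of [x' = S (M x + g)], whose vector field is
    [S] applied to the gradient of the energy. *)
Lemma hamiltonian_flow_le (R : realType) (d : nat) (M S : 'M[R]_d) (h : R)
    (g z : 'cV[R]_d) :
  M^T = M -> (forall x, quadmx S x <= 0) -> 0 <= h ->
  quad_energy M g (expmx (h *: (S *m M)) *m z +
    phi1mx (h *: (S *m M)) *m (h *: (S *m g))) <= quad_energy M g z.
Proof.
move=> symM S0 h0; apply: quad_energy_flow_le => // x.
rewrite -scalemxAl -mulmxA -scalerDr -mulmxDr dotcvZr.
by rewrite mulr_ge0_le0 ?S0.
Qed.

Unset Implicit Arguments.
Set Strict Implicit.

Theorem theorem4p2 (R : realType) (d : nat)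
    (M S : 'M[R]_d) (V : 'cV[R]_d -> R) (C : R) (D : R -> 'M[R]_d)
    (h tn tn1 : R) (zhat zn zn1 : 'cV[R]_d) (rn rn1 : R)
    (hM : posdefmx M)
    (hS : S^T = - S \/ negsemidefmx (symmx S))
    (hV : forall z : 'cV[R]_d, differentiable V z)
    (hC : 0 < C)
    (hVC : forall z : 'cV[R]_d, 0 < V z + C)
    (hDcont : continuous D)
    (hD : forall t : R, possemidefmx (symmx (M *m D t)))
    (hh : 0 < h)
    (htn1 : tn1 = tn + h)
    (hstep : seisav_step M S V C D h tn tn1 zhat (zn, rn) (zn1, rn1)) :
  modified_energy M C (zn1, rn1) - modified_energy M C (zn, rn) <= 0.
Proof.
have [symM _] := hM.
have D0 t x : 0 <= quadmx (M *m D t) x.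
  by rewrite -quadmx_symmx; case: (hD t) => _; exact.
case: hstep => zm [zp [rm [rp [[zmE rmE] zpE rpE [zn1E rn1E]]]]].
move: zpE rpE; move: (sav_direction _ _ _) => g zpE rpE.
have first_half : quadmx M zm <= quadmx M zn.
  by rewrite zmE; exact: damping_flow_le.
have second_half : quadmx M zn1 <= quadmx M zp.
  by rewrite zn1E; exact: damping_flow_le.
(* The nonlinear force frozen over the step; the factor (rp + rm) / 2 turns the
   increment of r ^+ 2 into that of the linear form gbar. *)
pose gbar := ((rp + rm) / 2) *: g.
have middle : quad_energy M gbar zp <= quad_energy M gbar zm.
  have -> : zp = expmx (h *: (S *m M)) *m zm +
      phi1mx (h *: (S *m M)) *m (h *: (S *m gbar)).
    rewrite zpE /gbar -!scalemxAr !scalerA -mulmxA; congr (_ + _ *: _).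
    by field.
  by apply: hamiltonian_flow_le => //; [move=> x; exact: quadmx_le0|exact: ltW].
have rpm : rp ^+ 2 - rm ^+ 2 = dotcv gbar zp - dotcv gbar zm.
  rewrite subr_sqr rpE dotcvDr dotcvNr !dotcvZl.
  by field.
move: middle first_half second_half rpm.
rewrite /modified_energy /quad_energy/= rn1E -rmE; lra.
Qed.
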